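(* Let $r\ge2$ and $s\ge r+1$. Suppose that $c\in A^{r-1}(Y^r_s)$ is a $(-1)$-Weyl line class, i.e. in the Weyl group orbit of $h-e_1-e_2$, with non-negative degree and multiplicities. Then $c$ is not Cremona reduced. If the degree of $c$ is larger than $r$, then the procedure of re-ordering the multiplicities in non-increasing order and applying the standard Cremona transformation $\phi$ to the $r+1$ largest multiplicities strictly reduces the degree, and it can be applied iteratively until one arrives at the class $rh-\sum_{i=1}^{r+3}e_i$ of the rational normal curve of degree $r$ through $r+3$ points. That class reduces to $h-e_1-e_2$ (up to re-ordering the indices) with one more application of $\phi$.
   Context: $Y^r_s$ is the blowup of $\mathbb{P}^r$ at $s$ general points. Its group of curve classes $A^{r-1}(Y^r_s)$ is the free abelian group with basis $h$ (class of a general line) and $e_1,\dots,e_s$ ($e_i$ the class of a line in the $i$-th exceptional divisor). For a class $c=dh-\sum_i m_ie_i$, $d$ is its degree and the $m_i$ are its multiplicities. For $I\subset\{1,\dots,s\}$ with $|I|=r+1$, the standard Cremona transformation $\phi_I$ acts on $A^{r-1}(Y^r_s)$ by $dh-\sum m_ie_i\mapsto d'h-\sum m_i'e_i$, where with $t=d-\sum_{i\in I}m_i$ one has $d'=d+(r-1)t$, $m_i'=m_i+t$ for $i\in I$, $m_i'=m_i$ for $i\notin I$; $\phi=\phi_{\{1,\dots,r+1\}}$. The Weyl group is generated by all $\phi_I$ and the permutations of $e_1,\dots,e_s$. A class is Cremona reduced if $d\ge\sum_{i\in I}m_i$ for every $(r+1)$-subset $I$ of the indices. *)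

(* Defs.v *)
From HB Require Import structures.
From mathcomp Require Import all_boot all_order all_algebra all_fingroup.
Set Implicit Arguments.
Unset Strict Implicit.
Unset Printing Implicit Defensive.
Import Order.TTheory GRing.Theory Num.Theory.
Local Open Scope ring_scope.

(* The group A^{r-1}(Y^r_s) of curve classes: the free abelian group on h and
   e_1, ..., e_s, given by coordinates in this basis.  As a group it does not
   depend on r.  The index set {1, ..., s} is 'I_s, so the index i is
   the ordinal of value i - 1. *)
Definition curve_class (s : nat) : zmodType := (int * {ffun 'I_s -> int})%type.

Section CurveClasses.
Variable s : nat.
Implicit Types (c : curve_class s) (m : 'I_s -> int) (I : {set 'I_s}).

Definition h : curve_class s := (1, 0).
Definition e (i : 'I_s) : curve_class s := (0, [ffun j => (j == i)%:R]).

Definition class_of (d : int) m : curve_class s :=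
  h *~ d - \sum_(i < s) e i *~ m i.

(* If c = d h - \sum_i m_i e_i then the multiplicity m_i is minus the
   coordinate of c on e_i. *)
Definition degree c : int := c.1.
Definition mult c (i : 'I_s) : int := - c.2 i.

Definition nonneg c : Prop := 0 <= degree c /\ forall i, 0 <= mult c i.

Definition cremona (r : nat) I c : curve_class s :=
  let t := degree c - \sum_(i in I) mult c i in
  class_of (degree c + (r%:Z - 1) * t)
           (fun i => if i \in I then mult c i + t else mult c i).

Definition std_cremona (r : nat) c : curve_class s :=
  cremona r [set i : 'I_s | (i < r.+1)%N] c.

(* The automorphism sending h to h and e_i to e_(sigma i). *)
Definition permute (sigma : {perm 'I_s}) c : curve_class s :=
  h *~ degree c - \sum_(i < s) e (sigma i) *~ mult c i.

(* The subgroup generated by the phi_I and the permutations (the identity is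
   the trivial permutation). *)
Inductive weyl_group (r : nat) : (curve_class s -> curve_class s) -> Prop :=
| Weyl_cremona I : #|I| = r.+1 -> weyl_group r (cremona r I)
| Weyl_permute sigma : weyl_group r (permute sigma)
| Weyl_comp u v : weyl_group r u -> weyl_group r v -> weyl_group r (u \o v)
| Weyl_inv u v :
    weyl_group r u -> cancel u v -> cancel v u -> weyl_group r v.

(* h - e_1 - e_2, when 2 <= s *)
Definition line_class : curve_class s := h - \sum_(i < s | (i < 2)%N) e i.

(* r h - e_1 - ... - e_(r+3), when r + 3 <= s *)
Definition rnc_class (r : nat) : curve_class s :=
  h *+ r - \sum_(i < s | (i < r + 3)%N) e i.

Definition weyl_line_class (r : nat) c : Prop :=
  exists2 w, weyl_group r w & c = w line_class.

Definition cremona_reduced (r : nat) c : Prop :=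
  forall I, #|I| = r.+1 -> \sum_(i in I) mult c i <= degree c.

Definition sort_mult c : curve_class s :=
  class_of (degree c)
    (fun i => nth 0 (sort >=%R [seq mult c j | j <- enum 'I_s]) i).

Definition reduction_step (r : nat) c : curve_class s :=
  std_cremona r (sort_mult c).

Lemma degree_class_of d m : degree (class_of d m) = d.
Proof.
rewrite /degree /class_of (raddfB fst) (raddf_sum fst) (raddfMz fst) /= intz.
by rewrite big1 ?subr0 // => i _; rewrite (raddfMz fst) /= mul0rz.
Qed.

Lemma mult_class_of d m i : mult (class_of d m) i = m i.
Proof.
rewrite /mult /class_of (raddfB snd) (raddf_sum snd) (raddfMz snd) /= mul0rz.
have eM j : (e j *~ m j).2 i = (i == j)%:R * m j.
  rewrite (raddfMz snd) /= -mulrzr; case: (m j) => n.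
    by rewrite -pmulrn mulr_natr ffunMnE ffunE -[Posz n]natz mulr_natr.
  by rewrite NegzE mulrNz -pmulrn mulrN mulr_natr ffunE ffunMnE ffunE mulrN
    -[Posz _]natz mulr_natr.
rewrite sub0r ffunE opprK sum_ffunE (bigD1 i) //= eM eqxx mul1r.
by rewrite big1 ?addr0 // => j ji; rewrite eM eq_sym (negPf ji) mul0r.
Qed.

Lemma class_of_degree_mult c : class_of (degree c) (mult c) = c.
Proof.
have E1 := degree_class_of (degree c) (mult c).
have E2 := mult_class_of (degree c) (mult c).
move: E1 E2; case: (class_of _ _) => d f; rewrite /degree /mult /= => -> E.
case: c E => d' f' /= E; congr pair; apply/ffunP => i.
by apply: oppr_inj; apply: E.
Qed.

End CurveClasses.

(* Main.v *)
From HB Require Import structures.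
Require Import Defs.
From mathcomp Require Import all_boot all_order all_algebra all_fingroup.
From mathcomp Require Import zify ring.
Import Order.TTheory GRing.Theory Num.Theory.
Local Open Scope ring_scope.

Set Implicit Arguments.
Unset Strict Implicit.
Unset Printing Implicit Defensive.

(** The Weyl group is generated by [s] simple reflections: the standard Cremona
    transformation, with root [(r-1)h - e_1 - ... - e_(r+1)], and the adjacent
    transpositions, with roots [e_i - e_(i+1)].  Their diagram is simply laced,
    and a class is dominant when its multiplicities are non-increasing and it
    is Cremona reduced.  Three facts carry the proof.

    Dominance ([dominant_pos], [dominant_degree]).  As in every Coxeter group, a
    dominant class [c] satisfies [w c = c + (non-negative combination of simple
    roots)] for all [w].  Simple roots have degree [0] or [r - 1], so a dominant
    class in the orbit of [h - e_1 - e_2], or of its negative, has degree at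
    most [1]; an orbit class with non-negative degree and multiplicities is
    therefore not dominant once degrees [0] and [1] are examined
    ([nonneg_orbit_defect]).  This is the first assertion, and it makes each
    reduction step lower the degree.

    Invariants ([orbit_linear], [orbit_quadratic], [orbit_degree_mod]).  On the
    orbit, [(r+1)d - (r-1) sum m_i = 3 - r] and
    [d^2 - (r-1) sum m_i^2 = 3 - 2r], and [d] is congruent to [1] modulo
    [r - 1].  Hence [(r-1) sum (m_i^2 - m_i) = (d-1)(d-r)]: a class of degree
    [1] or [r] has all multiplicities in [{0, 1}], and there are [2],
    respectively [r + 3], ones.

    Sign coherence ([orbit_coherent]).  The multiplicities of an orbit class are
    all non-negative or all non-positive.  By induction on [|d|] over the orbits
    of both [h - e_1 - e_2] and its negative, one may take [d >= 0]; if [d < r]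
    the invariants suffice.  If [d >= r] and the sorted class [c] has
    multiplicities of both signs, then [c] is not dominant, and the
    Cauchy-Schwarz inequality for its first [r + 1] multiplicities shows that
    the Cremona transform [c'] has [|d'| < d].  So [c'] is coherent; it keeps
    the negative last multiplicity of [c], so it is non-positive, and [c] has no
    positive multiplicity beyond the first [r + 1].  The linear invariant then
    makes their sum too large for Cauchy-Schwarz.  For [s = r + 1] no
    multiplicity is left out by [phi], but then all degrees in the orbit are [1]
    or [2 - r] ([orbit_degree_few_points]).

    Now let [d > r] with [c] non-negative.  Its transform [c'] is coherent.  If
    it were non-positive, then [c] would be supported on [r + 1] points, which
    Cauchy-Schwarz forbids as before; so [c'] is non-negative, and its degree is
    [1] or at least [r].  Degree [1] is impossible, because a non-negative class
    of degree [1] is transformed into one of degree at most [r].  So the degrees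
    decrease without skipping [r], where the class is that of the rational
    normal curve ([degree_r_class]). *)

(** * Dominant vectors for simply laced reflections *)

Section Reflections.

Variables (V : zmodType) (T : eqType) (alpha : T -> V).
Variable f : T -> {additive V -> int}.
Hypothesis f_self : forall i, f i (alpha i) = -2.
Hypothesis f_bond : forall i j, i != j ->
  (f i (alpha j) = 0 /\ f j (alpha i) = 0) \/
  (f i (alpha j) = 1 /\ f j (alpha i) = 1).

Definition reflect_at i v := v + alpha i *~ f i v.
Definition word_act (w : seq T) v := foldr reflect_at v w.

Lemma word_act_cons i w v : word_act (i :: w) v = reflect_at i (word_act w v).
Proof. by []. Qed.

Lemma word_act_rcons w i v : word_act (rcons w i) v = word_act w (reflect_at i v).
Proof. by rewrite /word_act foldr_rcons. Qed.

Lemma word_act_cat w1 w2 v : word_act (w1 ++ w2) v = word_act w1 (word_act w2 v).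
Proof. by rewrite /word_act foldr_cat. Qed.

Lemma reflect_atD i : {morph reflect_at i : u v / u + v}.
Proof. by move=> u v; rewrite /reflect_at raddfD mulrzDr addrACA. Qed.

Lemma reflect_atN i : {morph reflect_at i : u / - u}.
Proof. by move=> u; rewrite /reflect_at raddfN mulrNz opprD. Qed.

Lemma reflect_atK i : involutive (reflect_at i).
Proof.
move=> v; rewrite /reflect_at raddfD raddfMz /= f_self.
rewrite -addrA -mulrzDr; set x := f i v.
have -> : x + (x + (-2) *~ x) = 0 by rewrite -mulrzr intz; lia.
by rewrite mulr0z addr0.
Qed.

Lemma reflect_at_self i : reflect_at i (alpha i) = - alpha i.
Proof. by rewrite /reflect_at f_self mulrNz -pmulrn mulr2n opprD addNKr. Qed.

Lemma word_actD w : {morph word_act w : u v / u + v}.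
Proof. by elim: w => [|i w IH] u v //; rewrite !word_act_cons IH reflect_atD. Qed.

Lemma word_actN w : {morph word_act w : u / - u}.
Proof. by elim: w => [|i w IH] u //; rewrite !word_act_cons IH reflect_atN. Qed.

Lemma word_act0 w : word_act w 0 = 0.
Proof. by apply: (addrI (word_act w 0)); rewrite -word_actD !addr0. Qed.

Lemma word_actMz w (n : int) : {morph word_act w : u / u *~ n}.
Proof.
have actMn (k : nat) u : word_act w (u *+ k) = word_act w u *+ k.
  by elim: k => [|k IH]; rewrite ?mulr0n ?word_act0 // !mulrS word_actD IH.
by move=> u; case: n => k; rewrite ?NegzE ?mulrNz ?word_actN -?pmulrn actMn.
Qed.

Lemma word_actK w : cancel (word_act w) (word_act (rev w)).
Proof.
elim: w => [|i w IH] v //.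
by rewrite word_act_cons rev_cons word_act_rcons reflect_atK IH.
Qed.

Lemma f_reflect_at k j v :
  f k (reflect_at j v) = f k v + f k (alpha j) * f j v.
Proof. by rewrite raddfD raddfMz /= -mulrzr intz. Qed.

(** The right-hand side is symmetric in [i] and [j], which is the braid
    relation. *)
Lemma reflect_at3 i j v : f i (alpha j) = 1 -> f j (alpha i) = 1 ->
  reflect_at i (reflect_at j (reflect_at i v)) =
  v + (alpha i + alpha j) *~ (f i v + f j v).
Proof.
move=> fij fji.
have E2 : f j (reflect_at i v) = f i v + f j v.
  by rewrite f_reflect_at fji mul1r addrC.
have E3 : f i (reflect_at j (reflect_at i v)) = f j v.
  by rewrite f_reflect_at fij E2 f_reflect_at f_self; lia.
rewrite {1}/reflect_at E3 {1}/reflect_at E2 /reflect_at.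
by rewrite mulrzDl [alpha i *~ (_ + _)]mulrzDr addrAC -!addrA.
Qed.

Lemma reflect_at_braid i j v : f i (alpha j) = 1 -> f j (alpha i) = 1 ->
  reflect_at i (reflect_at j (reflect_at i v)) =
  reflect_at j (reflect_at i (reflect_at j v)).
Proof.
by move=> fij fji; rewrite !reflect_at3 // [alpha j + _]addrC [f j v + _]addrC.
Qed.

Lemma reflect_at_commute i j v : f i (alpha j) = 0 -> f j (alpha i) = 0 ->
  reflect_at i (reflect_at j v) = reflect_at j (reflect_at i v).
Proof.
move=> fij fji; rewrite {1 3}/reflect_at !f_reflect_at fij fji.
by rewrite !mul0r !addr0 /reflect_at addrAC.
Qed.

Variable pos : V -> Prop.
Hypothesis pos0 : pos 0.
Hypothesis posD : forall u v, pos u -> pos v -> pos (u + v).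
Hypothesis pos_alpha : forall i, pos (alpha i).

(** If the root [w alpha_i] is not positive, then [w s_i] has a shorter word.
    Stating the dichotomy for arbitrary words, rather than for the length
    function of the group, gives an induction on words with no appeal to
    minimal lengths.  When [w] ends in [t], only the dihedral group generated by
    [s_t] and [s_i] matters: it has order 4 or 6. *)
Lemma pos_or_shorter w i : pos (word_act w (alpha i)) \/
  exists2 w', (size w' < size w)%N & forall v, word_act w' v = word_act w (reflect_at i v).
Proof.
have [n] := ubnP (size w); elim: n w i => // n IH w i.
case/lastP: w => [|u t]; first by left; exact: pos_alpha.
rewrite size_rcons ltnS => ltn.
have IHn w' j : (size w' <= size u)%N -> _ := fun le => IH w' j (leq_ltn_trans le ltn).
have [<-|neq] := eqVneq t i.
  by right; exists u => // v; rewrite word_act_rcons reflect_atK.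
have [[fti fit]|[fti fit]] := f_bond neq.
- (* The reflections commute, and [w alpha_i = u alpha_i]. *)
  rewrite word_act_rcons {1}/reflect_at fti mulr0z addr0.
  have [pos_i|[u' lt_u' Eu']] := IHn u i (leqnn _); first by left.
  right; exists (rcons u' t) => [|v]; first by rewrite size_rcons.
  by rewrite !word_act_rcons Eu' reflect_at_commute.
- (* Here [w alpha_i = u alpha_i + u alpha_t].  If [u s_t] or [u s_i] has a
     shorter word, that word replaces the problem by a smaller one. *)
  have tai : reflect_at t (alpha i) = alpha i + alpha t.
    by rewrite /reflect_at fti mulr1z.
  have [pos_t|[u' lt_u' Eu']] := IHn u t (leqnn _); last first.
    have Ew v : word_act (rcons u t) v = word_act u' v by rewrite word_act_rcons Eu'.
    have [pos_i|[w' lt_w' Ew']] := IHn u' i (ltnW lt_u').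
      by left; rewrite Ew.
    right; exists w' => [|v]; last by rewrite Ew' Ew.
    by apply: leq_trans lt_w' _; apply: leqW; apply: ltnW.
  have [pos_i|[v lt_v Ev]] := IHn u i (leqnn _).
    by left; rewrite word_act_rcons tai word_actD; exact: posD.
  (* With [u = v s_i], the root [w alpha_i] is [v alpha_t], and
     [w s_i = v s_i s_t s_i = v s_t s_i s_t]. *)
  have Eu x : word_act u x = word_act v (reflect_at i x) by rewrite Ev reflect_atK.
  have [pos_vt|[v' lt_v' Ev']] := IHn v t (ltnW lt_v).
    left; rewrite word_act_rcons tai Eu reflect_atD reflect_at_self.
    by rewrite {1}/reflect_at fit mulr1z addrC addrK.
  right; exists (rcons (rcons v' i) t) => [|x].
    by rewrite !size_rcons; lia.
  by rewrite !word_act_rcons Ev' Eu -reflect_at_braid.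
Qed.

(** Writing [w = u s_i] gives [w c - c = (u c - c) + f_i(c) u alpha_i], whose
    last term is positive unless [w] can be shortened. *)
Lemma dominant_pos w c : (forall i, 0 <= f i c) -> pos (word_act w c - c).
Proof.
move=> dom; have [n] := ubnP (size w); elim: n w => // n IH w.
case/lastP: w => [|u i]; first by rewrite subrr.
rewrite size_rcons ltnS => ltn; rewrite word_act_rcons.
have [pos_i|[u' lt_u' Eu']] := pos_or_shorter u i; last first.
  by rewrite -Eu'; apply: IH; apply: ltn_trans ltn.
rewrite /reflect_at word_actD word_actMz addrAC; apply: posD; first exact: IH.
case: (f i c) (dom i) => // k _; rewrite -pmulrn.
by elim: k => [|k IHk]; rewrite ?mulr0n // mulrS; apply: posD.
Qed.

End Reflections.

(** * Degree and multiplicities as coordinates *)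

Section Coordinates.

Variable s : nat.
Implicit Types c : curve_class s.

Lemma class_eq c c' :
  degree c = degree c' -> (forall i, mult c i = mult c' i) -> c = c'.
Proof.
move=> Ed Em; rewrite -(class_of_degree_mult c) -(class_of_degree_mult c') Ed.
by rewrite /class_of; under eq_bigr do rewrite Em.
Qed.

Lemma degreeD c c' : degree (c + c') = degree c + degree c'.
Proof. by []. Qed.

Lemma multD c c' i : mult (c + c') i = mult c i + mult c' i.
Proof. by rewrite /mult ffunE opprD. Qed.

Lemma degreeN c : degree (- c) = - degree c.
Proof. by []. Qed.

Lemma multN c i : mult (- c) i = - mult c i.
Proof. by rewrite /mult ffunE. Qed.

Lemma degreeMz c n : degree (c *~ n) = n * degree c.
Proof. by rewrite /degree (raddfMz fst) /= -mulrzl intz. Qed.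

Lemma multMz c n i : mult (c *~ n) i = n * mult c i.
Proof.
have multMn (k : nat) : mult (c *+ k) i = k%:Z * mult c i.
  elim: k => [|k IH]; first by rewrite mulr0n mul0r /mult ffunE oppr0.
  by rewrite mulrS multD IH intS mulrDl mul1r.
by case: n => k; rewrite ?NegzE ?mulrNz ?multN -pmulrn multMn // mulNr.
Qed.

Lemma sum_ord_lt (k : nat) (F : nat -> int) : (k <= s)%N ->
  \sum_(i < s | (i < k)%N) F i = \sum_(i < k) F i.
Proof. by move=> le; rewrite (big_ord_widen _ F le). Qed.

Lemma card_ord_lt k : (k <= s)%N -> #|[set i : 'I_s | (i < k)%N]| = k.
Proof.
move=> le; rewrite -sum1_card; under eq_bigl do rewrite inE.
by rewrite -(big_ord_widen _ (fun=> 1%N) le) sum1_card card_ord.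
Qed.

Lemma permuteE (p : {perm 'I_s}) c :
  permute p c = class_of (degree c) (fun i => mult c (p^-1%g i)).
Proof.
rewrite /permute /class_of; congr (_ - _).
rewrite (reindex_inj (@perm_inj _ p^-1%g)) /=.
by apply: eq_bigr => i _; rewrite permKV.
Qed.

Lemma degree_permute (p : {perm 'I_s}) c : degree (permute p c) = degree c.
Proof. by rewrite permuteE degree_class_of. Qed.

Lemma mult_permute (p : {perm 'I_s}) c i : mult (permute p c) i = mult c (p^-1%g i).
Proof. by rewrite permuteE mult_class_of. Qed.

Lemma permuteM (p q : {perm 'I_s}) c :
  permute (p * q)%g c = permute q (permute p c).
Proof.
apply: class_eq => [|i]; rewrite ?degree_permute // !mult_permute.
by rewrite invMg permM.
Qed.

Lemma permute1 c : permute 1%g c = c.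
Proof.
by apply: class_eq => [|i]; rewrite ?degree_permute // mult_permute invg1 perm1.
Qed.

Lemma degree_cremona r (I : {set 'I_s}) c :
  degree (cremona r I c) =
  degree c + (r%:Z - 1) * (degree c - \sum_(i in I) mult c i).
Proof. exact: degree_class_of. Qed.

Lemma mult_cremona r (I : {set 'I_s}) c i :
  mult (cremona r I c) i =
  mult c i + (i \in I)%:R * (degree c - \sum_(i in I) mult c i).
Proof.
by rewrite /cremona mult_class_of; case: ifP => _; rewrite ?mul1r // mul0r addr0.
Qed.

Lemma sort_mult_permute c : exists2 p : {perm 'I_s}, sort_mult c = permute p c &
  forall i j : 'I_s, (i <= j)%N -> mult (permute p c) j <= mult (permute p c) i.
Proof.
set m := [tuple mult c j | j < s].
have Em : [seq mult c j | j <- enum 'I_s] = m by [].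
have /tuple_permP[p Ep] : perm_eq (sort >=%R m) m by rewrite perm_sort.
have Enth (i : 'I_s) : nth 0 (sort >=%R m) i = mult c (p i).
  by rewrite Ep -(tnth_nth 0 _ i) !tnth_mktuple.
exists p^-1%g => [|i j le_ij].
  by rewrite /sort_mult Em permuteE /class_of invgK; under eq_bigr do rewrite Enth.
rewrite !mult_permute invgK -!Enth.
have srt : sorted >=%R (sort >=%R m) by apply: sort_sorted => x y; exact: le_total.
apply: (sorted_leq_nth _ _ 0 srt) => //.
- by move=> x y z xy yz; exact: le_trans yz xy.
- by move=> x; exact: lexx.
- by rewrite inE size_sort size_tuple.
- by rewrite inE size_sort size_tuple.
Qed.

Lemma perm_initial (I : {set 'I_s}) :
  exists p : {perm 'I_s}, forall i, (p i \in I) = (i < #|I|)%N.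
Proof.
have Pe : perm_eq (enum I ++ enum (~: I)) (enum 'I_s).
  apply: uniq_perm; rewrite ?cat_uniq ?enum_uniq //.
    by rewrite andbT; apply/hasPn => i; rewrite !mem_enum inE.
  by move=> i; rewrite mem_cat !mem_enum !inE orbN.
have /tuple_permP[p Ep] : perm_eq (enum I ++ enum (~: I)) (ord_tuple s) by [].
exists p => i.
have -> : p i = nth i (enum I ++ enum (~: I)) i.
  by rewrite Ep -(tnth_nth i _ i) tnth_mktuple tnth_ord_tuple.
rewrite nth_cat -cardE; case: ltnP => lt.
  by rewrite -mem_enum mem_nth // -cardE.
apply/negbTE; rewrite -in_setC -mem_enum mem_nth // -cardE.
by rewrite ltn_subLR // cardsC card_ord.
Qed.

End Coordinates.

(** * Sums of squares of integers *)

Section IntegerSums.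

Variable T : finType.

Lemma sum_sq_ge_sum (m : T -> int) : \sum_i m i <= \sum_i m i ^+ 2.
Proof. by apply: ler_sum => i _; nia. Qed.

Lemma zero_one_of_sum_sq (m : T -> int) :
  \sum_i m i ^+ 2 = \sum_i m i -> forall i, m i = 0 \/ m i = 1.
Proof.
move=> E i; have ge0 (j : T) : true -> 0 <= m j ^+ 2 - m j by move=> _; nia.
have /(psumr_eq0P ge0)/(_ i isT) : \sum_j (m j ^+ 2 - m j) = 0 by rewrite sumrB E subrr.
by nia.
Qed.

Lemma sum_indicator (I : {set T}) (m : T -> int) :
  \sum_i (i \in I)%:R * m i = \sum_(i in I) m i.
Proof.
rewrite [RHS]big_mkcond; apply: eq_bigr => i _.
by case: ifP; rewrite ?mul1r ?mul0r.
Qed.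

(** Cauchy-Schwarz, from the non-negativity of the sum of the squares
    [(|I| m_i - S)^2], where [S] is the sum of the [m_i]. *)
Lemma sum_sq_le (I : {set T}) (m : T -> int) :
  (\sum_(i in I) m i) ^+ 2 <= #|I|%:Z * \sum_(i in I) m i ^+ 2.
Proof.
set S := \sum_(i in I) m i; set Q := \sum_(i in I) _.
have [/eqP|I0] := posnP #|I|.
  rewrite cards_eq0 => /eqP I0.
  by rewrite /S /Q I0 !big_set0 cards0 mulr0 expr0n.
have : 0 <= \sum_(i in I) (#|I|%:Z * m i - S) ^+ 2.
  by apply: sumr_ge0 => i _; exact: sqr_ge0.
have -> : \sum_(i in I) (#|I|%:Z * m i - S) ^+ 2 = #|I|%:Z * (#|I|%:Z * Q - S ^+ 2).
  transitivity (\sum_(i in I) (#|I|%:Z ^+ 2 * m i ^+ 2 + (- 2 * #|I|%:Z * S) * m i + S ^+ 2)).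
    by apply: eq_bigr => i _; ring.
  rewrite !big_split /= -!mulr_sumr -/S -/Q sumr_const -mulr_natl.
  by rewrite natz; ring.
by rewrite pmulr_rge0 ?subr_ge0 // ltz_nat.
Qed.

End IntegerSums.

(** * The Weyl group as a group of words in simple reflections *)

Section SimpleReflections.

Variables (r s : nat).
Implicit Types (c : curve_class s) (eps : int).
Notation R := (r%:Z).

Definition initial : {set 'I_s} := [set i : 'I_s | (i < r.+1)%N].

Definition ord_prev (i : 'I_s) : 'I_s :=
  Ordinal (leq_ltn_trans (leq_pred i) (ltn_ord i)).

(** The number [t] by which [phi] shifts the first [r + 1] multiplicities. *)
Definition defect c : int := degree c - \sum_(i in initial) mult c i.

Definition simple_root (i : 'I_s) : curve_class s :=
  if i == 0%N :> nat then class_of (r%:Z - 1) (fun j => (j \in initial)%:R)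
  else class_of 0 (fun j => (j == i)%:R - (j == ord_prev i)%:R).

Definition simple_coroot (i : 'I_s) c : int :=
  if i == 0%N :> nat then defect c else mult c (ord_prev i) - mult c i.

Lemma simple_coroot_is_zmod_morphism i : zmod_morphism (simple_coroot i).
Proof.
move=> c c'; rewrite /simple_coroot /defect; case: ifP => _.
  rewrite degreeD degreeN; under eq_bigr do rewrite multD multN.
  by rewrite sumrB; ring.
by rewrite !multD !multN; lia.
Qed.

HB.instance Definition _ i := GRing.isZmodMorphism.Build (curve_class s) int
  (simple_coroot i) (simple_coroot_is_zmod_morphism i).

Hypotheses (hr : (2 <= r)%N) (hs : (r + 1 <= s)%N).

Lemma card_initial : #|initial| = r.+1.
Proof. by apply: card_ord_lt; lia. Qed.

Lemma sum_initial_pred1 (k : 'I_s) :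
  \sum_(j in initial) (j == k)%:R = ((k < r.+1)%N)%:R :> int.
Proof.
rewrite big_mkcond (bigD1 k) //= big1 => [|j jk].
  by rewrite addr0 eqxx inE; case: ifP.
by rewrite (negPf jk); case: ifP.
Qed.

Lemma coroot_self i : simple_coroot i (simple_root i) = -2.
Proof.
rewrite /simple_coroot /simple_root; case: eqVneq => [_|i0].
  rewrite /defect degree_class_of; under eq_bigr => j Ij do rewrite mult_class_of Ij.
  by rewrite sumr_const card_initial; lia.
rewrite !mult_class_of !eqxx.
have neq : i != ord_prev i by apply: contra_neq i0 => /(congr1 val) /=; lia.
by rewrite (negPf neq) eq_sym (negPf neq).
Qed.

(** The diagram is the chain of the transpositions, with the Cremona node
    attached, when [s > r + 1], to the transposition that exchanges the ordinals
    [r] and [r + 1]. *)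
Lemma coroot_bond i j : i != j ->
  (simple_coroot i (simple_root j) = 0 /\ simple_coroot j (simple_root i) = 0) \/
  (simple_coroot i (simple_root j) = 1 /\ simple_coroot j (simple_root i) = 1).
Proof.
have first_bond (k l : 'I_s) : k = 0%N :> nat -> l != 0%N :> nat ->
  simple_coroot k (simple_root l) = (l == r.+1 :> nat)%:R /\
  simple_coroot l (simple_root k) = (l == r.+1 :> nat)%:R.
  move=> k0 l0; rewrite /simple_coroot /simple_root k0 eqxx (negPf l0) /defect.
  rewrite degree_class_of; under eq_bigr do rewrite mult_class_of.
  rewrite sumrB !sum_initial_pred1 !mult_class_of !inE /=.
  by split; lia.
move=> ij; case: (eqVneq (i : nat) 0%N) (eqVneq (j : nat) 0%N) => [i0|i0] [j0|j0].
- by case/eqP: ij; apply: val_inj; rewrite /= i0 j0.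
- by have [-> ->] := first_bond i j i0 j0; case: eqP; [right|left].
- by have [-> ->] := first_bond j i j0 i0; case: eqP; [right|left].
rewrite /simple_coroot /simple_root (negPf i0) (negPf j0) !mult_class_of.
rewrite -!(inj_eq val_inj) /=; move: ij; rewrite -(inj_eq val_inj) /= => ij.
rewrite [(j.-1 == i.-1)%N]eq_sym [(j == i :> nat)]eq_sym (negPf ij).
rewrite [(i == j.-1 :> nat)]eq_sym [(j == i.-1 :> nat)]eq_sym.
have -> : (i.-1 == j.-1)%N = false by lia.
case: (eqVneq i.-1 (j : nat)) (eqVneq j.-1 (i : nat)) => [Ei|_] [Ej|_];
  by [lia|right|right|left].
Qed.

Notation word := (seq 'I_s).
Notation simple_reflection := (reflect_at simple_root simple_coroot).
Notation wact := (word_act simple_root simple_coroot).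

Lemma reflection_first (i : 'I_s) c : i = 0%N :> nat -> simple_reflection i c = std_cremona r c.
Proof.
move=> i0; rewrite /reflect_at /simple_root /= /simple_coroot i0 eqxx /std_cremona.
apply: class_eq => [|j].
  by rewrite degreeD degreeMz degree_class_of degree_cremona /defect -/initial; ring.
by rewrite multD multMz mult_class_of mult_cremona /defect -/initial mulrC.
Qed.

Lemma reflection_swap (i : 'I_s) c : i != 0%N :> nat ->
  simple_reflection i c = permute (tperm (ord_prev i) i) c.
Proof.
move=> i0; rewrite /reflect_at /simple_root /= /simple_coroot (negPf i0).
have neq : i != ord_prev i by apply: contra_neq i0 => /(congr1 val) /=; lia.
apply: class_eq => [|j].
  by rewrite degreeD degreeMz degree_class_of degree_permute mulr0 addr0.
rewrite multD multMz mult_class_of mult_permute tpermV.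
case: tpermP => [->|->|/eqP jp /eqP ji].
- by rewrite eq_sym (negPf neq) eqxx; lia.
- by rewrite eqxx (negPf neq); lia.
- by rewrite (negPf jp) (negPf ji); lia.
Qed.

Definition is_word (u : curve_class s -> curve_class s) :=
  exists w : word, forall c, u c = wact w c.

Lemma is_word_comp u v : is_word u -> is_word v -> is_word (u \o v).
Proof. by move=> [w Ew] [w' Ew']; exists (w ++ w') => c; rewrite word_act_cat /= Ew Ew'. Qed.

Lemma is_word_ext u v : u =1 v -> is_word u -> is_word v.
Proof. by move=> E [w Ew]; exists w => c; rewrite -E. Qed.

Lemma is_word_std : is_word (std_cremona r).
Proof.
have s0 : (0 < s)%N by lia.
by exists [:: Ordinal s0] => c; rewrite /= reflection_first.
Qed.

(** Conjugating the transposition of [i] and [j - 1] by the adjacent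
    transposition of [j - 1] and [j] gives that of [i] and [j]. *)
Lemma is_word_tperm (i j : 'I_s) : (i < j)%N -> is_word (permute (tperm i j)).
Proof.
case: j => j; elim: j => // j IH ltj; rewrite ltnS /= leq_eqVlt.
have ltj' := ltnW ltj.
have Ep : ord_prev (Ordinal ltj) = Ordinal ltj' by apply: val_inj.
have adj : is_word (permute (tperm (Ordinal ltj') (Ordinal ltj))).
  exists [:: Ordinal ltj] => c; rewrite -Ep.
  by have := reflection_swap (i := Ordinal ltj) c isT.
case/orP => [/eqP Ei|lt_ij]; first by have -> : i = Ordinal ltj' by exact: val_inj.
have word_i := IH ltj' lt_ij.
have -> : tperm i (Ordinal ltj) =
    (tperm i (Ordinal ltj') ^ tperm (Ordinal ltj') (Ordinal ltj))%g.
  rewrite tpermJ tpermL tpermD // -(inj_eq val_inj) /=; lia.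
apply: is_word_ext (is_word_comp adj (is_word_comp word_i adj)) => c.
by rewrite /conjg tpermV !permuteM.
Qed.

Lemma is_word_permute p : is_word (permute p).
Proof.
have [ts -> _] := prod_tpermP p.
elim: ts => [|[i j] ts IH]; first by rewrite big_nil; exists [::] => c; rewrite permute1.
rewrite big_cons.
apply: (@is_word_ext
    (permute (\prod_(t <- ts) tperm t.1 t.2)%g \o permute (tperm i j))) => [c|].
  by rewrite permuteM.
apply: is_word_comp; first exact: IH.
case: (ltngtP i j) => [lt|lt|/val_inj ->].
- exact: is_word_tperm.
- by rewrite tpermC; exact: is_word_tperm.
- by rewrite tperm1; exists [::] => c; rewrite permute1.
Qed.

(** Conjugating [phi] by a permutation that carries the first [r + 1] indices to
    [I] gives [phi_I]. *)
Lemma is_word_cremona (I : {set 'I_s}) : #|I| = r.+1 -> is_word (cremona r I).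
Proof.
move=> cardI; have [p Ip] := perm_initial I; rewrite cardI in Ip.
have sumE c : \sum_(i in I) mult c i =
    \sum_(i in initial) mult (permute p^-1%g c) i.
  rewrite (reindex_inj (@perm_inj _ p)) /=.
  by apply: eq_big => [i|i _]; rewrite ?inE ?Ip // mult_permute invgK.
apply: is_word_ext (is_word_comp (is_word_permute p)
  (is_word_comp is_word_std (is_word_permute p^-1%g))) => c /=.
apply: class_eq => [|i].
  by rewrite degree_permute !degree_cremona degree_permute sumE.
rewrite mult_permute !mult_cremona !mult_permute degree_permute sumE invgK permKV.
by have -> : (i \in I) = (p^-1%g i \in initial) by rewrite inE -Ip permKV.
Qed.

Lemma weyl_group_word u : weyl_group r u -> is_word u.
Proof.
elim=> [I|p|u1 v1 _ IHu _ IHv|u1 v1 _ [w Ew] uv vu].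
- exact: is_word_cremona.
- exact: is_word_permute.
- exact: is_word_comp.
- exists (rev w) => c.
  by rewrite -{2}(vu c) Ew word_actK //; exact: coroot_self.
Qed.

(** * Invariants of the orbit *)

Definition mult_sum c : int := \sum_i mult c i.
Definition mult_sum_sq c : int := \sum_i mult c i ^+ 2.

Lemma mult_sum_permute p c : mult_sum (permute p c) = mult_sum c.
Proof.
rewrite /mult_sum [RHS](reindex_inj (@perm_inj _ p^-1%g)).
by apply: eq_bigr => i _; rewrite mult_permute.
Qed.

Lemma mult_sum_sq_permute p c : mult_sum_sq (permute p c) = mult_sum_sq c.
Proof.
rewrite /mult_sum_sq [RHS](reindex_inj (@perm_inj _ p^-1%g)).
by apply: eq_bigr => i _; rewrite mult_permute.
Qed.

Lemma degree_std c : degree (std_cremona r c) = degree c + (R - 1) * defect c.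
Proof. exact: degree_cremona. Qed.

Lemma mult_std c i : mult (std_cremona r c) i = mult c i + (i \in initial)%:R * defect c.
Proof. exact: mult_cremona. Qed.

Lemma mult_sum_std c :
  mult_sum (std_cremona r c) = mult_sum c + (R + 1) * defect c.
Proof.
rewrite /mult_sum; under eq_bigr do rewrite mult_std.
rewrite big_split /= sum_indicator sumr_const card_initial //; congr (_ + _).
by rewrite -mulr_natl -natr1 natz.
Qed.

Lemma mult_sum_sq_std c :
  mult_sum_sq (std_cremona r c) = mult_sum_sq c
    + 2 * defect c * (degree c - defect c) + (R + 1) * defect c ^+ 2.
Proof.
set t := defect c.
transitivity (\sum_i (mult c i ^+ 2 + (i \in initial)%:R * (2 * t * mult c i + t ^+ 2))).
  by apply: eq_bigr => i _; rewrite mult_std -/t; case: (i \in initial) => /=; ring.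
rewrite big_split /= sum_indicator big_split /= -mulr_sumr sumr_const card_initial //.
have -> : \sum_(i in initial) mult c i = degree c - t by rewrite /t /defect subKr.
by rewrite -[t ^+ 2 *+ _]mulr_natl -natr1 natz /mult_sum_sq; ring.
Qed.

(** The sign [eps] selects the orbit of the line class or that of its negative.
    These orbits differ in general, and the proof of coherence, which replaces a
    class by its negative, needs both. *)
Definition is_orbit eps c := exists w, c = wact w (line_class s *~ eps).

Lemma class_of_initial (d : int) k :
  class_of d (fun i : 'I_s => ((i < k)%N)%:R) = h s *~ d - \sum_(i < s | (i < k)%N) e i.
Proof.
rewrite /class_of; congr (_ - _); rewrite [RHS]big_mkcond.
by apply: eq_bigr => i _; case: ifP; rewrite ?mulr1z ?mulr0z.
Qed.

Lemma line_classE : line_class s = class_of 1 (fun i => ((i < 2)%N)%:R).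
Proof. by rewrite class_of_initial mulr1z. Qed.

Lemma rnc_classE : rnc_class s r = class_of R (fun i => ((i < r + 3)%N)%:R).
Proof. by rewrite class_of_initial -pmulrn. Qed.

Lemma mult_sum_line : mult_sum (line_class s) = 2.
Proof.
rewrite /mult_sum line_classE; under eq_bigr do rewrite mult_class_of.
transitivity (\sum_(i < s | (i < 2)%N) 1 : int).
  rewrite [RHS]big_mkcond; apply: eq_bigr => i _; by case: ifP.
rewrite (sum_ord_lt (fun=> 1)); last by lia.
by rewrite sumr_const card_ord.
Qed.

Lemma mult_sum_sq_line : mult_sum_sq (line_class s) = 2.
Proof.
rewrite -mult_sum_line /mult_sum_sq /mult_sum; apply: eq_bigr => i _.
by rewrite line_classE mult_class_of; case: (_ < _)%N.
Qed.

Lemma is_orbit_word eps u c :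
  is_word u -> is_orbit eps c -> is_orbit eps (u c).
Proof. by move=> [w Ew] [w' ->]; exists (w ++ w'); rewrite word_act_cat Ew. Qed.

Lemma is_orbit_permute eps p c : is_orbit eps c -> is_orbit eps (permute p c).
Proof. by apply: is_orbit_word; exact: is_word_permute. Qed.

Lemma is_orbit_std eps c : is_orbit eps c -> is_orbit eps (std_cremona r c).
Proof. by apply: is_orbit_word; exact: is_word_std. Qed.

Lemma is_orbitN eps c : is_orbit eps c -> is_orbit (- eps) (- c).
Proof. by move=> [w ->]; exists w; rewrite mulrNz word_actN. Qed.

Lemma weyl_line_class_orbit c : weyl_line_class r c -> is_orbit 1 c.
Proof.
move=> [u /weyl_group_word Wu ->]; apply: is_orbit_word; first exact: Wu.
by exists [::]; rewrite mulr1z.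
Qed.

Lemma orbit_ind eps (P : curve_class s -> Prop) :
  P (line_class s *~ eps) -> (forall p c, P c -> P (permute p c)) ->
  (forall c, P c -> P (std_cremona r c)) -> forall c, is_orbit eps c -> P c.
Proof.
move=> P0 Pp Ps c [w ->]; elim: w => //= i w IH.
have [i0|i0] := eqVneq (i : nat) 0%N.
  by rewrite (reflection_first _ i0); apply: Ps.
by rewrite (reflection_swap _ i0); apply: Pp.
Qed.

Lemma orbit_linear eps c : is_orbit eps c ->
  (R + 1) * degree c - (R - 1) * mult_sum c = eps * (3 - R).
Proof.
move: c; apply: orbit_ind => [|p c|c].
- rewrite degreeMz /mult_sum; under eq_bigr do rewrite multMz.
  rewrite -mulr_sumr -/(mult_sum _) mult_sum_line line_classE degree_class_of.
  by ring.
- by rewrite degree_permute mult_sum_permute.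
- by rewrite degree_std mult_sum_std => <-; ring.
Qed.

Lemma orbit_quadratic eps c : eps ^+ 2 = 1 -> is_orbit eps c ->
  degree c ^+ 2 - (R - 1) * mult_sum_sq c = 3 - 2 * R.
Proof.
move=> eps2; move: c; apply: orbit_ind => [|p c|c].
- rewrite degreeMz /mult_sum_sq; under eq_bigr do rewrite multMz exprMn eps2 mul1r.
  rewrite -/(mult_sum_sq _) mult_sum_sq_line line_classE degree_class_of.
  by rewrite mulr1 eps2; ring.
- by rewrite degree_permute mult_sum_sq_permute.
- by rewrite degree_std mult_sum_sq_std => <-; ring.
Qed.

Lemma orbit_degree_mod eps c : is_orbit eps c ->
  exists k, degree c = eps + (R - 1) * k.
Proof.
move: c; apply: orbit_ind => [|p c|c [k Ek]].
- by exists 0; rewrite degreeMz line_classE degree_class_of; ring.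
- by rewrite degree_permute.
- by exists (k + defect c); rewrite degree_std Ek; ring.
Qed.

(** With [s = r + 1] points there is a single [phi], and the linear invariant
    determines its effect on the degree: it exchanges [eps] and
    [eps (2 - r)].  This case is separate because no index lies outside the
    first [r + 1], so the coherence argument has nothing to work with. *)
Lemma orbit_degree_few_points eps c : s = r.+1 -> is_orbit eps c ->
  degree c = eps \/ degree c = eps * (2 - R).
Proof.
move=> sr oc; suff [] : (degree c = eps \/ degree c = eps * (2 - R)) /\ is_orbit eps c by [].
elim/orbit_ind: oc => {c} [|p c [dc oc]|c [dc oc]].
- split; last by exists [::].
  by left; rewrite degreeMz line_classE degree_class_of mulr1.
- by rewrite degree_permute; split=> //; exact: is_orbit_permute.
split; last exact: is_orbit_std.
have Edef : defect c = degree c - mult_sum c.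
  rewrite /defect /mult_sum; congr (_ - _); apply: eq_bigl => i.
  by rewrite !inE; have := ltn_ord i; lia.
have lin := orbit_linear oc.
rewrite degree_std Edef.
have -> : degree c + (R - 1) * (degree c - mult_sum c) =
  - degree c + ((R + 1) * degree c - (R - 1) * mult_sum c) by ring.
by rewrite lin; case: dc => ->; [right|left]; ring.
Qed.

(** The cone used here records a vector by its degree and, in degree [0], by the
    sum of its first [r + 1] multiplicities.  It contains the simple roots: the
    Cremona root has degree [r - 1 > 0], and a transposition root leaves that sum
    unchanged or lowers it by [1].  Since the line class is [w c] for some [w],
    its difference with [c] lies in the cone. *)
Lemma dominant_degree eps c : is_orbit eps c ->
  (forall i j : 'I_s, (i <= j)%N -> mult c j <= mult c i) -> 0 <= defect c ->
  degree c < eps \/ degree c = eps /\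
    \sum_(i in initial) mult (line_class s *~ eps) i <= \sum_(i in initial) mult c i.
Proof.
move=> [w Ec] sorted_c def_c.
pose pos v := 0 < degree v \/
  degree v = 0 /\ \sum_(i in initial) mult v i <= 0.
have pos0 : pos 0.
  by right; split=> //; rewrite big1 // => i _; rewrite /mult ffunE oppr0.
have posD u v : pos u -> pos v -> pos (u + v).
  rewrite /pos degreeD; under [\sum_(i in _) mult (u + v) i]eq_bigr do rewrite multD.
  rewrite big_split /= => -[du|[-> mu]] [dv|[-> mv]]; rewrite ?add0r ?addr0.
  - by left; exact: addr_gt0.
  - by left.
  - by left.
  - by right; split=> //; rewrite -[0]addr0 lerD.
have pos_root i : pos (simple_root i).
  rewrite /pos /simple_root; case: eqVneq => [_|i0]; rewrite degree_class_of.
    by left; lia.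
  right; split=> //; under eq_bigr do rewrite mult_class_of.
  by rewrite sumrB !sum_initial_pred1 /=; lia.
have dom i : 0 <= simple_coroot i c.
  rewrite /simple_coroot; case: eqVneq => // i0.
  by rewrite subr_ge0 sorted_c //= leq_pred.
have := dominant_pos (coroot_self) coroot_bond pos0 posD pos_root (rev w) dom.
rewrite {1}Ec word_actK; last exact: coroot_self.
rewrite /pos degreeD degreeN degreeMz {1 2}line_classE degree_class_of.
under eq_bigr do rewrite multD multN.
rewrite sumrB mulr1 subr_gt0 subr_le0 => -[|[/eqP]]; first by left.
by rewrite subr_eq0 => /eqP ->; right.
Qed.

End SimpleReflections.

(** * Sign coherence of the multiplicities *)

Section Coherence.

Variables (r s : nat).
Hypotheses (hr : (2 <= r)%N) (hs : (r + 1 <= s)%N).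
Implicit Types (c : curve_class s) (eps : int).
Notation initial := (initial r s).
Notation R := (r%:Z).

Definition coherent c :=
  (forall i, 0 <= mult c i) \/ (forall i, mult c i <= 0).

Lemma coherentN c : coherent (- c) -> coherent c.
Proof.
by case=> H; [right|left] => i; have := H i; rewrite multN; lia.
Qed.

Lemma coherent_permute p c : coherent (permute p c) -> coherent c.
Proof.
by case=> H; [left|right] => i; have := H (p i); rewrite mult_permute permK.
Qed.

Lemma coherent_zero_one c : mult_sum_sq c = mult_sum c -> coherent c.
Proof. by move=> /zero_one_of_sum_sq H; left => i; case: (H i) => ->. Qed.

Lemma mult_sumN c : mult_sum (- c) = - mult_sum c.
Proof. by rewrite /mult_sum -sumrN; apply: eq_bigr => i _; rewrite multN. Qed.

Lemma mult_sum_sqN c : mult_sum_sq (- c) = mult_sum_sq c.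
Proof. by apply: eq_bigr => i _; rewrite multN sqrrN. Qed.

(** The congruence leaves few degrees below [r].  In the orbit of the line class
    these are [1] and, for [r = 2], also [0]; in the opposite orbit, [r - 2] and,
    for [r = 2], also [1].  This last case would make the sum of the squares of
    the multiplicities smaller than their sum; in the others the invariants make
    it equal to plus or minus their sum. *)
Lemma small_degree_coherent eps c : eps = 1 \/ eps = -1 -> is_orbit r eps c ->
  0 <= degree c < R -> coherent c.
Proof.
move=> eps1 oc /andP[d0 dr].
have lin := orbit_linear hr hs oc.
have quad : degree c ^+ 2 - (R - 1) * mult_sum_sq c = 3 - 2 * R.
  by apply: (orbit_quadratic hr hs _ oc); case: eps1 => ->.
have [k Ek] := orbit_degree_mod hr hs oc.
have := sum_sq_ge_sum (mult c); rewrite -/(mult_sum c) -/(mult_sum_sq c) => le.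
have [[r2 E]|E] : (R = 2 /\ mult_sum_sq c = - mult_sum c) \/ mult_sum_sq c = mult_sum c.
  case: eps1 Ek lin => -> Ek lin.
    have [k0|k0] : k = 0 \/ (R = 2 /\ k = -1) by nia.
      by right; nia.
    by left; case: k0 => r2 kE; rewrite r2 kE in Ek lin quad *; nia.
  have [k1|[r2 k2]] : k = 1 \/ (R = 2 /\ k = 2) by nia.
    by right; nia.
  by rewrite r2 k2 in Ek lin quad; nia.
- by apply: coherentN; apply: coherent_zero_one; rewrite mult_sum_sqN mult_sumN.
- exact: coherent_zero_one.
Qed.

(** If the conclusion failed, squaring it and dividing by [r + 1] would give
    [2 d^2 <= (r-1)(2r-3) < 2 r^2], against [r <= d]. *)
Lemma initial_sum_bound (d S : int) : R <= d ->
  (R - 1) * S ^+ 2 <= (R + 1) * (d ^+ 2 + 2 * R - 3) -> (R - 1) * S < (R + 1) * d.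
Proof.
move=> Rd H; rewrite ltNge; apply/negP => le.
have R2 : 2 <= R by lia.
have sq : ((R + 1) * d) ^+ 2 <= ((R - 1) * S) ^+ 2 by rewrite ler_sqr ?nnegrE //; nia.
have H2 : (R + 1) * d ^+ 2 <= (R - 1) * (d ^+ 2 + 2 * R - 3).
  rewrite -(ler_pM2l (x := R + 1)); last by lia.
  apply: le_trans (_ : (R - 1) * ((R - 1) * S ^+ 2) <= _).
    by move: sq; rewrite !exprMn; nia.
  by rewrite [X in _ <= X]mulrCA ler_pM2l //; lia.
have sqR : R ^+ 2 <= d ^+ 2 by rewrite ler_sqr ?nnegrE //; lia.
have : 2 * d ^+ 2 <= 2 * R ^+ 2 - 5 * R + 3 by lia.
lia.
Qed.

Lemma orbit_initial_sum_sq eps c : eps = 1 \/ eps = -1 -> is_orbit r eps c ->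
  (R - 1) * (\sum_(i in initial) mult c i) ^+ 2
    <= (R + 1) * (degree c ^+ 2 + 2 * R - 3).
Proof.
move=> eps1 oc.
have quad : degree c ^+ 2 - (R - 1) * mult_sum_sq c = 3 - 2 * R.
  by apply: (orbit_quadratic hr hs _ oc); case: eps1 => ->.
have := sum_sq_le initial (mult c); rewrite card_initial //.
set S := \sum_(i in initial) mult c i; set Q := \sum_(i in initial) _ => leSQ.
have leQ : Q <= mult_sum_sq c.
  rewrite /Q /mult_sum_sq big_mkcond; apply: ler_sum => i _.
  by case: ifP => // _; exact: sqr_ge0.
have -> : degree c ^+ 2 + 2 * R - 3 = (R - 1) * mult_sum_sq c by lia.
rewrite [X in _ <= X]mulrCA ler_pM2l; last by lia.
by apply: le_trans leSQ _; apply: ler_pM => //; [apply: sumr_ge0 => i _; exact: sqr_ge0|lia].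
Qed.

Lemma mult_sum_initial c :
  mult_sum c = \sum_(i in initial) mult c i + \sum_(i | i \notin initial) mult c i.
Proof. by rewrite /mult_sum (bigID (mem initial)). Qed.

(** The induction on [|d|] works because [phi] strictly lowers [|d|] on a sorted
    class of degree at least [r] with multiplicities of both signs. *)
Lemma orbit_coherent eps c : eps = 1 \/ eps = -1 -> is_orbit r eps c -> coherent c.
Proof.
have [n] := ubnP `|degree c|%N; elim: n eps c => // n IH eps c ltn eps1 oc.
wlog d0 : eps c ltn eps1 oc / 0 <= degree c.
  move=> W; have [|d0] := lerP 0 (degree c); first exact: W oc.
  apply: coherentN; apply: (W (- eps)); rewrite ?degreeN.
  - by rewrite abszN.
  - by case: eps1 => ->; [right|left].
  - exact: is_orbitN.
  - by lia.
have [dR|Rd] := ltrP (degree c) R.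
  by apply: (small_degree_coherent eps1 oc); rewrite d0.
have [p _ srt] := sort_mult_permute c.
apply: (@coherent_permute p).
have {oc} := is_orbit_permute hr hs p oc.
move: ltn d0 Rd; rewrite -{1 2 3}(degree_permute p c).
move: (permute p c) srt => {}c srt ltn d0 Rd oc.
have s_big : (r.+1 < s)%N.
  rewrite ltn_neqAle -{2}addn1 hs andbT; apply/eqP => sr.
  by have := orbit_degree_few_points hr hs (esym sr) oc; case: eps1 => ->; lia.
have neg : defect r c < 0.
  rewrite ltNge; apply/negP => def0.
  by have := dominant_degree hr hs oc srt def0; case: eps1 => ->; lia.
have bnd := initial_sum_bound Rd (orbit_initial_sum_sq eps1 oc).
(* The last index carries the smallest multiplicity and is fixed by [phi]. *)
have lts : (s.-1 < s)%N by lia.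
pose z := Ordinal lts.
have [z0|z0] := lerP 0 (mult c z).
  left=> i; apply: le_trans z0 (srt i z _); rewrite /=; have := ltn_ord i; lia.
have zI : z \notin initial by rewrite inE /=; lia.
have Eout i : i \notin initial -> mult (std_cremona r c) i = mult c i.
  by move=> iI; rewrite mult_std (negPf iI) mul0r addr0.
have [coh|coh] : coherent (std_cremona r c).
- apply: (IH eps) => //; last exact: is_orbit_std.
  move: neg bnd ltn; rewrite degree_std /defect.
  set S := \sum_(i in initial) mult c i; nia.
- by have := coh z; rewrite Eout //; lia.
have out_neg : \sum_(i | i \notin initial) mult c i <= mult c z.
  rewrite (bigD1 z) //= gerDl; apply: sumr_le0 => i /andP[iI _].
  by rewrite -Eout.
have := mult_sum_initial c; have := orbit_linear hr hs oc; move: bnd out_neg z0.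
set S := \sum_(i in initial) mult c i; set O := \sum_(i | _) mult c i.
by case: eps1 => ->; nia.
Qed.

(** * Reduction of non-negative orbit classes *)

Lemma sum_initial_line : \sum_(i in initial) mult (line_class s) i = 2.
Proof.
rewrite -(mult_sum_line hr hs) mult_sum_initial [X in _ + X]big1 ?addr0 // => i.
rewrite inE line_classE mult_class_of; case: (i < 2)%N / idP => //; lia.
Qed.

(** A dominant class would have degree [0] or [1].  In degree [0] the congruence
    forces [r = 2], and then the multiplicities would sum to [-1].  In degree [1]
    the first [r + 1] multiplicities would sum to at least [2], as they do for
    the line, which exceeds the degree. *)
Lemma nonneg_orbit_defect c : is_orbit r 1 c -> nonneg c ->
  (forall i j : 'I_s, (i <= j)%N -> mult c j <= mult c i) -> defect r c < 0.
Proof.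
move=> oc [d0 m0] srt; rewrite ltNge; apply/negP => def0.
have lin := orbit_linear hr hs oc; have [k Ek] := orbit_degree_mod hr hs oc.
have sum0 : 0 <= mult_sum c by apply: sumr_ge0.
case: (dominant_degree hr hs oc srt def0) => [d1|[d1]].
  have dc : degree c = 0 by lia.
  rewrite dc in Ek; have k_lt0 : k < 0 by nia.
  have r2 : R = 2 by nia.
  by rewrite r2 dc in lin; lia.
rewrite mulr1z sum_initial_line => le2; move: def0; rewrite /defect d1.
by rewrite subr_ge0 => /(le_trans le2).
Qed.

Lemma is_orbit_sort eps c : is_orbit r eps c -> is_orbit r eps (sort_mult c).
Proof. by have [p -> _] := sort_mult_permute c; exact: is_orbit_permute. Qed.

Lemma degree_sort c : degree (sort_mult c) = degree c.
Proof. by have [p -> _] := sort_mult_permute c; exact: degree_permute. Qed.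

Lemma nonneg_sort c : nonneg c -> nonneg (sort_mult c).
Proof.
move=> [d0 m0]; have [p -> _] := sort_mult_permute c.
by split=> [|i]; rewrite ?degree_permute ?mult_permute.
Qed.

Lemma sort_mult_sorted c (i j : 'I_s) :
  (i <= j)%N -> mult (sort_mult c) j <= mult (sort_mult c) i.
Proof. by have [p -> srt] := sort_mult_permute c; exact: srt. Qed.

Lemma orbit_not_reduced c : is_orbit r 1 c -> nonneg c -> ~ cremona_reduced r c.
Proof.
move=> oc c0 red; have := nonneg_orbit_defect (is_orbit_sort oc) (nonneg_sort c0)
  (@sort_mult_sorted c).
have [p -> _] := sort_mult_permute c.
rewrite ltNge /defect degree_permute subr_ge0 => /negP; apply.
have -> : \sum_(i in initial) mult (permute p c) i =
    \sum_(i in p @^-1: initial) mult c i.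
  rewrite (reindex_inj (@perm_inj _ p)); apply: eq_big => [i|i _].
    by rewrite !inE.
  by rewrite mult_permute permK.
by apply: red; rewrite card_preimset ?card_initial //; exact: perm_inj.
Qed.

Lemma degree_step c : degree (reduction_step r c) =
  degree c + (R - 1) * defect r (sort_mult c).
Proof. by rewrite /reduction_step degree_std degree_sort. Qed.

Lemma step_degree_lt c : is_orbit r 1 c -> nonneg c ->
  degree (reduction_step r c) < degree c.
Proof.
move=> oc c0; rewrite degree_step.
have := nonneg_orbit_defect (is_orbit_sort oc) (nonneg_sort c0) (@sort_mult_sorted c).
by nia.
Qed.

Lemma is_orbit_step eps c : is_orbit r eps c -> is_orbit r eps (reduction_step r c).
Proof. by move=> oc; apply: is_orbit_std => //; exact: is_orbit_sort. Qed.

(** This is where coherence is used: the transform is either non-negative or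
    non-positive, and non-positivity would confine the support of [c] to the
    first [r + 1] points. *)
Lemma std_nonneg c : is_orbit r 1 c -> nonneg c -> R < degree c ->
  nonneg (std_cremona r c) /\ R <= degree (std_cremona r c).
Proof.
move=> oc [d0 m0] Rd; have oc' := is_orbit_std hr hs oc.
have m'0 i : 0 <= mult (std_cremona r c) i.
  have [//|nonpos] := orbit_coherent (or_introl erefl) oc'.
  have Eout : \sum_(i | i \notin initial) mult c i = 0.
    apply: big1 => j jI; apply: le_anti; rewrite m0 andbT.
    by have := nonpos j; rewrite mult_std (negPf jI) mul0r addr0.
  have := orbit_linear hr hs oc; have := orbit_initial_sum_sq (or_introl erefl) oc.
  rewrite mult_sum_initial Eout addr0; set S := \sum_(j in initial) mult c j => sq lin.
  have bnd := initial_sum_bound (ltW Rd) sq.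
  (* The linear invariant refutes [bnd] directly for [r >= 3]; for [r = 2] the
     sum is [3d - 1], and the quadratic bound itself is violated. *)
  have r2 : R = 2 by lia.
  by rewrite r2 in sq lin Rd; nia.
have sum_pos : 0 < mult_sum (std_cremona r c).
  rewrite lt_neqAle sumr_ge0 // andbT eq_sym; apply/negP => /eqP sum0.
  have all0 := psumr_eq0P (fun i _ => m'0 i) sum0.
  have := orbit_quadratic hr hs (expr1n _ 2) oc'.
  rewrite /mult_sum_sq big1 => [|i _]; first by nia.
  by rewrite all0 // expr0n.
have lin := orbit_linear hr hs oc'; have [k Ek] := orbit_degree_mod hr hs oc'.
have d'1 : 1 <= degree (std_cremona r c) by nia.
split; first by split=> //; lia.
(* Degree [1] is excluded: the transform has a non-negative sum over the first
   [r + 1] indices, so [phi] cannot have lowered the degree from above [r]. *)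
suff k0 : k != 0 by nia.
apply/eqP => k0; rewrite k0 mulr0 addr0 degree_std in Ek.
have : 0 <= \sum_(i in initial) mult (std_cremona r c) i by apply: sumr_ge0.
under eq_bigr => i iI do rewrite mult_std iI mul1r.
rewrite big_split /= sumr_const card_initial // -mulr_natl -natr1 natz.
have -> : \sum_(i in initial) mult c i = degree c - defect r c by rewrite subKr.
by nia.
Qed.

Lemma step_nonneg c : is_orbit r 1 c -> nonneg c -> R < degree c ->
  nonneg (reduction_step r c) /\ R <= degree (reduction_step r c).
Proof.
move=> oc c0 Rd; apply: std_nonneg; first exact: is_orbit_sort.
  exact: nonneg_sort.
by rewrite degree_sort.
Qed.

(** The set of indices with multiplicity [1] is closed downwards, so it is the
    initial segment of its cardinality. *)
Lemma sorted_zero_one c (n : nat) : (forall i, mult c i = 0 \/ mult c i = 1) ->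
  (forall i j : 'I_s, (i <= j)%N -> mult c j <= mult c i) -> mult_sum c = n ->
  (n <= s)%N /\ forall i, mult c i = ((i < n)%N)%:R.
Proof.
move=> m01 srt sum_n; pose A := [set i | mult c i == 1].
have m_A i : mult c i = (i \in A)%:R.
  by rewrite inE; case: (m01 i) => ->.
have cardA : #|A| = n.
  apply/eqP; rewrite -eqz_nat -sum_n /mult_sum (eq_bigr _ (fun i _ => m_A i)).
  by rewrite -natr_sum -sum1_card big_mkcond natz.
split=> [|i]; first by rewrite -cardA -[X in (_ <= X)%N]card_ord max_card.
rewrite m_A; congr (_%:R); congr nat_of_bool.
have downA (j k : 'I_s) : (j <= k)%N -> k \in A -> j \in A.
  by move=> /srt; rewrite !m_A; case: (k \in A) => //; case: (j \in A).
rewrite -cardA; case: (boolP (i \in A)) => iA; apply/esym.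
  rewrite -(card_ord_lt (ltn_ord i)); apply: subset_leq_card.
  by apply/subsetP => j; rewrite inE ltnS => /downA; apply.
apply/negbTE; rewrite -leqNgt -(card_ord_lt (ltnW (ltn_ord i))).
apply: subset_leq_card; apply/subsetP => j jA; rewrite inE ltnNge.
by apply: contra iA => /downA; apply.
Qed.

Lemma sort_mult_zero_one c (n : nat) : (forall i, mult c i = 0 \/ mult c i = 1) ->
  mult_sum c = n ->
  (n <= s)%N /\ sort_mult c = class_of (degree c) (fun i => ((i < n)%N)%:R).
Proof.
move=> m01 sum_n.
have [|||le_ns m_sort] := @sorted_zero_one (sort_mult c) n.
- by have [p -> _] := sort_mult_permute c => i; rewrite mult_permute.
- exact: sort_mult_sorted.
- by have [p -> _] := sort_mult_permute c; rewrite mult_sum_permute.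
split=> //; apply: class_eq => [|i]; first by rewrite degree_class_of degree_sort.
by rewrite mult_class_of m_sort.
Qed.

Lemma degree_r_class c : is_orbit r 1 c -> degree c = R ->
  (r + 3 <= s)%N /\ sort_mult c = rnc_class s r.
Proof.
move=> oc dc; have lin := orbit_linear hr hs oc.
have quad := orbit_quadratic hr hs (expr1n _ 2) oc; rewrite dc in lin quad.
have sum_r3 : mult_sum c = (r + 3)%N by nia.
have sq_r3 : mult_sum_sq c = mult_sum c by nia.
have [le ->] := sort_mult_zero_one (zero_one_of_sum_sq sq_r3) sum_r3.
by rewrite rnc_classE dc.
Qed.

(** Every step keeps the class non-negative, lowers the degree and does not take
    it below [r], so it stops at degree exactly [r]. *)
Lemma reduction_chain c : is_orbit r 1 c -> nonneg c -> R < degree c ->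
  (r + 3 <= s)%N /\ exists n : nat,
    (forall k : nat, (k < n)%N ->
       let ck := iter k (reduction_step r) c in
       nonneg ck /\ R < degree ck /\ degree (reduction_step r ck) < degree ck) /\
    sort_mult (iter n (reduction_step r) c) = rnc_class s r.
Proof.
have [N] := ubnP `|degree c|%N; elim: N c => // N IH c ltN oc c0 Rd.
have [c'0 Rd'] := step_nonneg oc c0 Rd.
have lt_d := step_degree_lt oc c0.
have oc' := is_orbit_step oc.
have [d'R|d'R] := eqVneq (degree (reduction_step r c)) R.
  have [le Esort] := degree_r_class oc' d'R.
  by split=> //; exists 1%N; split=> // -[].
have [||le [n [steps last_step]]] := IH _ _ oc' c'0; [lia|lia|].
split=> //; exists n.+1; split=> [[|k]|]; first by [].
- by rewrite ltnS iterSr; exact: steps.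
- by rewrite iterSr.
Qed.

(** The transform of the rational normal curve has degree [1] and two
    multiplicities equal to [1], so sorting it gives the line. *)
Lemma std_rnc_line : (r + 3 <= s)%N ->
  sort_mult (std_cremona r (rnc_class s r)) = line_class s.
Proof.
move=> le; set c := rnc_class s r.
have mc i : mult c i = ((i < r + 3)%N)%:R by rewrite /c rnc_classE mult_class_of.
have dc : degree c = R by rewrite /c rnc_classE degree_class_of.
have def_c : defect r c = -1.
  rewrite /defect dc; under eq_bigr => i iI.
    have -> : mult c i = 1 by rewrite mc; move: iI; rewrite inE; case: ltnP => //; lia.
    over.
  by rewrite sumr_const card_initial // -natr1 natz; lia.
have sum_c : mult_sum c = R + 3.
  rewrite /mult_sum (eq_bigr _ (fun i _ => mc i)).
  transitivity (\sum_(i < s | (i < r + 3)%N) 1 : int).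
    by rewrite [RHS]big_mkcond; apply: eq_bigr => i _; case: ifP.
  by rewrite (sum_ord_lt (fun=> 1)) // sumr_const card_ord natz; lia.
have [||_ ->] := @sort_mult_zero_one (std_cremona r c) 2.
- move=> i; rewrite mult_std def_c mc inE.
  by case: (ltnP i (r + 3)); case: (ltnP i r.+1); lia.
- by rewrite mult_sum_std // sum_c def_c; lia.
- by rewrite line_classE degree_std dc def_c; congr class_of; lia.
Qed.

End Coherence.

Theorem proposition5p8 (r s : nat) (hr : (2 <= r)%N) (hs : (r + 1 <= s)%N) :
  (forall c : curve_class s, weyl_line_class r c -> nonneg c ->
     ~ cremona_reduced r c /\
     (r%:Z < degree c ->
        degree (reduction_step r c) < degree c /\
        (r + 3 <= s)%N /\
        exists n : nat,
          (forall k : nat, (k < n)%N ->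
             let ck := iter k (reduction_step r) c in
             nonneg ck /\ r%:Z < degree ck /\
             degree (reduction_step r ck) < degree ck) /\
          sort_mult (iter n (reduction_step r) c) = rnc_class s r)) /\
  ((r + 3 <= s)%N ->
     exists sigma : {perm 'I_s},
       permute sigma (std_cremona r (rnc_class s r)) = line_class s).
Proof.
split=> [c wc c0|le].
  have oc := weyl_line_class_orbit hr hs wc.
  split; first exact: orbit_not_reduced.
  move=> Rd; split; first exact: step_degree_lt.
  exact: reduction_chain.
have [p Ep _] := sort_mult_permute (std_cremona r (rnc_class s r)).
by exists p; rewrite -Ep std_rnc_line.
Qed.
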